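(* Consider the discrete-time LPV plant in LFT form $$\begin{bmatrix} z_{k+1} \\ \varphi_k \\ e_k \\ \hat{y}_k \end{bmatrix} = \begin{bmatrix} A_{ss} & A_{sp} & B_{1s} & B_{2s}\\ A_{ps} & A_{pp} & B_{1p} & B_{2p}\\ C_{1s} & C_{1p} & D_{11} & D_{12} \\ C_{2s} & C_{2p} & D_{21} & 0 \end{bmatrix} \begin{bmatrix} z_k \\ \vartheta_k \\ d_k \\ u_k \end{bmatrix}, \quad \vartheta_k = \Delta(k)\varphi_k,\quad z_0 \in \mathbb{I},$$ with $z_k\in\mathbb{R}^N$, $N=n+\bar N$, $\Delta(k) = \mathrm{diag}(\delta_k^{[1]} I_{m_1}, \dots, \delta_k^{[p]} I_{m_p})$, where the scheduling parameters satisfy $|\delta_k^{[i]}|\le 1$ for all $k$ and $i$ (otherwise arbitrary), and $\mathbb{I} = \{(\bar p,\bar q) : \bar p\in\varepsilon(P),\ \bar q\in\varepsilon(Q)\}$ with $P\in\mathbb{S}^n$, $Q\in\mathbb{S}^{\bar N}$ positive definite and $\varepsilon(P)=\{y: y^TPy\le 1\}$. Suppose the state variables are exactly measurable, i.e., $C_{2s} = I$, $C_{2p} = 0$, and $D_{21} = 0$. Then a static, state-feedback, $(\bar{h},1)$-eventually periodic nonstationary LPV (NSLPV) controller, with $\bar{h} \geq 0$, such that the closed loop is robustly stable and $$\sup \{\lVert e \rVert_{\ell_2} \mid \lVert d \rVert_{\ell_2} \leq 1,\ |\delta^{[i]}_k|\le 1\ \forall i,k,\ z_0 \in \mathbb{I}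 \}< \gamma,$$ exists if there exist positive definite matrices $R_0(k) \in \mathbb{S}^{N}$, $R_i(k) \in \mathbb{S}^{m_i}$, $S_i(k) \in \mathbb{S}^{m_i}$ for $i \in \{1,\dots,p\}$ and $k = 0,1,\dots,\bar{h}$, and positive scalars $b$, $f_{11}$, $f_{12}$, $f_{2}$, $g$, $t$ such that $$b + f_{11} + f_{12} + f_2 < 2\gamma, \quad \begin{bmatrix} F_1 & \Gamma^T \\ \Gamma & R_0(0) \end{bmatrix} \succ 0,$$ $$N_R^T \left\{ H \begin{bmatrix} R_0(k) & 0 & 0 \\ 0 & \bar{R}(k) & 0 \\ 0 & 0 & g I \end{bmatrix} H^T - \begin{bmatrix} R_0(k+1) & 0 & 0 \\ 0 & \bar{R}(k) & 0 \\ 0 & 0 & b I \end{bmatrix} \right\} N_R \prec 0,$$ $$\begin{bmatrix} \begin{bmatrix} \bar{S}(k) & 0 \\ 0 & f_2 I \end{bmatrix} - H_{22}^T\begin{bmatrix} \bar{S}(k) & 0 \\ 0 & tI \end{bmatrix}H_{22} & H_{12}^T \\ H_{12} & R_0(k+1) \end{bmatrix} \succ 0,$$ $$\begin{bmatrix} R_i(k) & I \\ I & S_i(k) \end{bmatrix} \succeq 0, \quad \begin{bmatrix} g & 1 \\ 1 & f_2 \end{bmatrix} \succeq 0, \quad \begin{bmatrix} t & 1 \\ 1 & b \end{bmatrix} \succeq 0,$$ for $i = 1,\dots,p$ and $k = 0,1,\dots,\bar{h}$, where $R_0(\bar{h}+1) = R_0(\bar{h})$, $\Gamma = \mathrm{diag}(P^{-1/2},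 Q^{-1/2})$, $F_1 = \mathrm{diag}(f_{11} I_n, f_{12}I_{\bar{N}})$, $\bar{R}(k) = \mathrm{diag}(R_1(k), \dots, R_p(k))$, $\bar{S}(k) = \mathrm{diag}(S_1(k), \dots, S_p(k))$, $N_R$ satisfies $\mathrm{Im}\, N_R = \mathrm{Ker} \begin{bmatrix} B_{2s}^T & B_{2p}^T & D_{12}^T \end{bmatrix}$ and $N_R^TN_R = I$, and $$H = \begin{bmatrix} H_{11} & H_{12} \\ H_{21} & H_{22} \end{bmatrix} = \left[ \begin{array}{c|cc} A_{ss} & A_{sp} & B_{1s} \\ \hline A_{ps} & A_{pp} & B_{1p} \\ C_{1s} & C_{1p} & D_{11} \end{array} \right].$$
   Context: A matrix sequence $P$ is $(h,q)$-eventually periodic if $P(h+k+iq)=P(h+k)$ for all nonnegative integers $i,k$; a system is $(h,q)$-eventually periodic if all its state-space matrix sequences are. An NSLPV controller has state-space matrices depending explicitly on both the scheduling parameters and time; here the static controller has the form $\varphi^c_k = A^c_{pp}(k)\vartheta^c_k + B^c_p(k)\hat y_k$, $u_k = C^c_p(k)\vartheta^c_k + D^c(k)\hat y_k$, $\vartheta^c_k = \mathrm{diag}(\delta_k^{[1]}I_{m^c_1(k)},\dots,\delta_k^{[p]}I_{m^c_p(k)})\varphi^c_k$. $\mathbb{S}^m$ denotes real symmetric $m\times m$ matrices; $\mathrm{Im}$ and $\mathrm{Ker}$ denote image and kernel. *)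

(* Defs.v *)
From HB Require Import structures.
From mathcomp Require Import all_boot all_order all_algebra.
From mathcomp Require Import reals.
Set Implicit Arguments. Unset Strict Implicit. Unset Printing Implicit Defensive.
Import Order.TTheory GRing.Theory Num.Theory.
Local Open Scope ring_scope.

Section Defs.
Variable R : realType.

Definition posdef (m : nat) (A : 'M[R]_m) : Prop :=
  A^T = A /\ forall x : 'cV[R]_m, x != 0 -> 0 < (x^T *m A *m x) 0 0.
Definition possemidef (m : nat) (A : 'M[R]_m) : Prop :=
  A^T = A /\ forall x : 'cV[R]_m, 0 <= (x^T *m A *m x) 0 0.
Definition negdef (m : nat) (A : 'M[R]_m) : Prop := posdef (- A).

Definition diag2 (a b : nat) (A : 'M[R]_a) (B : 'M[R]_b) : 'M[R]_(a + b) :=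
  block_mx A 0 0 B.

Definition sdiag (p : nat) (m : 'I_p -> nat) (dl : 'I_p -> R)
  : 'M[R]_(\sum_i m i) := \mxdiag_(i < p) ((dl i)%:M : 'M[R]_(m i)).

Definition bdiag (p : nat) (m : 'I_p -> nat) (X : forall i, 'M[R]_(m i))
  : 'M[R]_(\sum_i m i) := \mxdiag_(i < p) X i.

Definition sqnorm (m : nat) (v : 'cV[R]_m) : R := \sum_i (v i 0) ^+ 2.
Definition vnorm (m : nat) (v : 'cV[R]_m) : R := Num.sqrt (sqnorm v).

(* State z in R^(n+Nb), N = n + Nb; theta, phi in R^(sum_i m_i);
   d in R^nd, u in R^nu, e in R^ne; measurement yhat in R^N
   (since C2s = I it has the dimension of the state). *)
Record plant (n Nb p : nat) (m : 'I_p -> nat) (nd nu ne : nat) := Plant {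
  Ass : 'M[R]_(n + Nb, n + Nb); Asp : 'M[R]_(n + Nb, \sum_i m i);
  B1s : 'M[R]_(n + Nb, nd);     B2s : 'M[R]_(n + Nb, nu);
  Aps : 'M[R]_(\sum_i m i, n + Nb); App : 'M[R]_(\sum_i m i, \sum_i m i);
  B1p : 'M[R]_(\sum_i m i, nd);     B2p : 'M[R]_(\sum_i m i, nu);
  C1s : 'M[R]_(ne, n + Nb); C1p : 'M[R]_(ne, \sum_i m i);
  D11 : 'M[R]_(ne, nd);     D12 : 'M[R]_(ne, nu);
  C2s : 'M[R]_(n + Nb, n + Nb); C2p : 'M[R]_(n + Nb, \sum_i m i);
  D21 : 'M[R]_(n + Nb, nd) }.

Record sctrl (p N nu : nat) := SCtrl {
  mc  : 'I_p -> nat;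
  Acpp : 'M[R]_(\sum_i mc i, \sum_i mc i);
  Bcp  : 'M[R]_(\sum_i mc i, N);
  Ccp  : 'M[R]_(nu, \sum_i mc i);
  Dcc  : 'M[R]_(nu, N) }.

Definition ev_periodic (T : Type) (h q : nat) (P : nat -> T) : Prop :=
  forall i k, P (h + k + i * q)%N = P (h + k)%N.

Context (n Nb p : nat) (m : 'I_p -> nat) (nd nu ne : nat).
Local Notation N := (n + Nb)%N.
Local Notation M := (\sum_i m i)%N.

Definition alg_eqs (G : plant n Nb m nd nu ne) (c : sctrl p N nu)
  (dl : 'I_p -> R) (z : 'cV[R]_N) (d : 'cV[R]_nd)
  (th ph : 'cV[R]_M) (u : 'cV[R]_nu) (y : 'cV[R]_N)
  (thc phc : 'cV[R]_(\sum_i mc c i)) : Prop :=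
  [/\ ph = Aps G *m z + App G *m th + B1p G *m d + B2p G *m u,
      y = C2s G *m z + C2p G *m th + D21 G *m d
    & th = sdiag m dl *m ph] /\
  [/\ phc = Acpp c *m thc + Bcp c *m y,
      u = Ccp c *m thc + Dcc c *m y
    & thc = sdiag (mc c) dl *m phc].

Arguments alg_eqs : clear implicits.

Definition admissible_param (dl : 'I_p -> R) : Prop := forall i, `|dl i| <= 1.
Definition admissible (dl : nat -> 'I_p -> R) : Prop :=
  forall k, admissible_param (dl k).

Definition wellposed (G : plant n Nb m nd nu ne) (K : nat -> sctrl p N nu) : Prop :=
  forall k dl, admissible_param dl -> forall z d,
    exists! x : 'cV[R]_M * 'cV[R]_M * 'cV[R]_nu * 'cV[R]_N
                * 'cV[R]_(\sum_i mc (K k) i) * 'cV[R]_(\sum_i mc (K k) i),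
      alg_eqs G (K k) dl z d x.1.1.1.1.1 x.1.1.1.1.2 x.1.1.1.2 x.1.1.2 x.1.2 x.2.

Definition cl_traj (G : plant n Nb m nd nu ne) (K : nat -> sctrl p N nu)
  (dl : nat -> 'I_p -> R) (z : nat -> 'cV[R]_N) (d : nat -> 'cV[R]_nd)
  (e : nat -> 'cV[R]_ne) : Prop :=
  exists (th ph : nat -> 'cV[R]_M) (u : nat -> 'cV[R]_nu) (y : nat -> 'cV[R]_N)
         (thc phc : forall k, 'cV[R]_(\sum_i mc (K k) i)),
  forall k,
    [/\ alg_eqs G (K k) (dl k) (z k) (d k) (th k) (ph k) (u k) (y k) (thc k) (phc k),
        z k.+1 = Ass G *m z k + Asp G *m th k + B1s G *m d k + B2s G *m u k
      & e k = C1s G *m z k + C1p G *m th k + D11 G *m d k + D12 G *m u k].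

Definition robustly_stable (G : plant n Nb m nd nu ne) (K : nat -> sctrl p N nu) : Prop :=
  wellposed G K /\
  forall dl, admissible dl ->
    exists c lam : R, 0 < c /\ 0 <= lam < 1 /\
      forall z e, cl_traj G K dl z (fun _ => 0) e ->
        forall j k, (j <= k)%N -> vnorm (z k) <= c * lam ^+ (k - j) * vnorm (z j).

Definition in_init (P : 'M[R]_n) (Q : 'M[R]_Nb) (z0 : 'cV[R]_N) : Prop :=
  exists (pb : 'cV[R]_n) (qb : 'cV[R]_Nb),
    z0 = col_mx pb qb /\ (pb^T *m P *m pb) 0 0 <= 1 /\ (qb^T *m Q *m qb) 0 0 <= 1.

(* sup { ||e||_l2 : ||d||_l2 <= 1, |delta| <= 1, z0 in I } < gamma *)
Definition perf_lt (G : plant n Nb m nd nu ne) (K : nat -> sctrl p N nu)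
  (P : 'M[R]_n) (Q : 'M[R]_Nb) (gamma : R) : Prop :=
  exists gam' : R, 0 <= gam' < gamma /\
    forall dl z d e, admissible dl -> cl_traj G K dl z d e -> in_init P Q (z 0%N) ->
      (forall T, \sum_(k < T) sqnorm (d k) <= 1) ->
      forall T, \sum_(k < T) sqnorm (e k) <= gam' ^+ 2.

End Defs.

(* Main.v *)
Require Import Defs.
From HB Require Import structures.
From mathcomp Require Import all_boot all_order all_algebra.
From mathcomp Require Import reals boolp ring lra.
Import Order.TTheory GRing.Theory Num.Theory.
Local Open Scope ring_scope.
Set Implicit Arguments. Unset Strict Implicit. Unset Printing Implicit Defensive.

(** Put [P k := R0(k)^-1], [Q := diag(R_i^-1)] and [T := diag(S_i - R_i^-1 + eps)] with a small
    [eps > 0].  The controller runs a copy [thc] of the scheduling channel [th]; with the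
    storage function [z^T P z] and multipliers [Q] on [th], [T] on [th - thc], one needs
      [P(k+1)[z+] + Q[ph] + T[ph - phc] + |e|^2/b < P(k)[z] + Q[th] + T[th - thc] + f2 |d|^2].
    The controller sees [(z, thc)] and chooses [(u, phc)]; [(th, d)] is hidden from it.  The
    [S]-inequality makes this quadratic game strictly concave in [(th, d)], so its first-order
    conditions define a saddle point linear in [(z, thc)].  At the saddle point the value is
    the minimum over [(u, phc)], which the [N_R]-inequality makes negative (take [phc = ph]).
    Contractivity of the scheduling blocks removes [Q] and [T], leaving well-posedness,
    exponential decay, and [|e|^2 <= b (f11 + f12 + f2) <= ((b + f11 + f12 + f2)/2)^2]. *)

(** * Bilinear forms and squared norms *)

Section BilinearForms.
Variable R : realType.

Definition bf (n : nat) (A : 'M[R]_n) (x y : 'cV[R]_n) : R := (x^T *m A *m y) 0 0.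

Lemma bfDl n (A : 'M_n) x y z : bf A (x + y) z = bf A x z + bf A y z.
Proof. by rewrite /bf linearD /= !mulmxDl mxE. Qed.
Lemma bfDr n (A : 'M_n) x y z : bf A x (y + z) = bf A x y + bf A x z.
Proof. by rewrite /bf mulmxDr mxE. Qed.
Lemma bfNl n (A : 'M_n) x y : bf A (- x) y = - bf A x y.
Proof. by rewrite /bf linearN /= !mulNmx mxE. Qed.
Lemma bfNr n (A : 'M_n) x y : bf A x (- y) = - bf A x y.
Proof. by rewrite /bf mulmxN mxE. Qed.
Lemma bfZl n (A : 'M_n) a x y : bf A (a *: x) y = a * bf A x y.
Proof. by rewrite /bf linearZ /= -!scalemxAl mxE. Qed.
Lemma bfZr n (A : 'M_n) a x y : bf A x (a *: y) = a * bf A x y.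
Proof. by rewrite /bf -scalemxAr mxE. Qed.
Lemma bf0l n (A : 'M_n) y : bf A 0 y = 0.
Proof. by rewrite /bf trmx0 !mul0mx mxE. Qed.
Lemma bf0r n (A : 'M_n) x : bf A x 0 = 0.
Proof. by rewrite /bf mulmx0 mxE. Qed.
Lemma bfC n (A : 'M_n) x y : A^T = A -> bf A x y = bf A y x.
Proof.
move=> AT; rewrite /bf; have <- : (x^T *m A *m y)^T = y^T *m A *m x.
  by rewrite !trmx_mul trmxK AT mulmxA.
by rewrite [RHS]mxE.
Qed.
Lemma bf_addm n (A B : 'M_n) x y : bf (A + B) x y = bf A x y + bf B x y.
Proof. by rewrite /bf mulmxDr mulmxDl mxE. Qed.
Lemma bf_oppm n (A : 'M_n) x y : bf (- A) x y = - bf A x y.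
Proof. by rewrite /bf mulmxN mulNmx mxE. Qed.
Lemma bf_congr n k (A : 'M_n) (B : 'M_(n, k)) x y :
  bf (B^T *m A *m B) x y = bf A (B *m x) (B *m y).
Proof. by rewrite /bf trmx_mul !mulmxA. Qed.
Lemma bf_mulr n (A B : 'M_n) x y : bf A x (B *m y) = bf (A *m B) x y.
Proof. by rewrite /bf !mulmxA. Qed.
Lemma bf_diag2 n1 n2 (A : 'M_n1) (B : 'M_n2) x1 x2 y1 y2 :
  bf (diag2 A B) (col_mx x1 x2) (col_mx y1 y2) = bf A x1 y1 + bf B x2 y2.
Proof.
by rewrite /bf /diag2 tr_col_mx mul_row_block !mulmx0 addr0 add0r mul_row_col mxE.
Qed.
Lemma bf_scalar n a (x : 'cV_n) : bf a%:M x x = a * sqnorm x.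
Proof.
rewrite /bf mul_mx_scalar -scalemxAl mxE; congr (_ * _).
by rewrite mxE; apply: eq_bigr => i _; rewrite mxE expr2.
Qed.

Lemma sqnorm_ge0 n (x : 'cV[R]_n) : 0 <= sqnorm x.
Proof. by apply: sumr_ge0 => i _; apply: sqr_ge0. Qed.
Lemma sqnorm_eq0 n (x : 'cV[R]_n) : (sqnorm x == 0) = (x == 0).
Proof.
apply/eqP/eqP => [h|->]; last first.
  by rewrite /sqnorm big1 // => i _; rewrite mxE expr0n.
apply/matrixP => i j; rewrite ord1 mxE; apply/eqP; rewrite -sqrf_eq0.
by have /psumr_eq0P/(_ i isT)/eqP : \sum_k (x k 0) ^+ 2 = 0; [|apply=> k _; apply: sqr_ge0].
Qed.
Lemma sqnorm_gt0 n (x : 'cV[R]_n) : (0 < sqnorm x) = (x != 0).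
Proof. by rewrite lt_def sqnorm_ge0 andbT sqnorm_eq0. Qed.
Lemma sqnorm_col n1 n2 (x : 'cV[R]_n1) (y : 'cV[R]_n2) :
  sqnorm (col_mx x y) = sqnorm x + sqnorm y.
Proof.
rewrite /sqnorm big_split_ord /=; congr (_ + _); apply: eq_bigr => i _.
- by rewrite col_mxEu.
- by rewrite col_mxEd.
Qed.

(** * Positive definite forms: Cauchy-Schwarz, inverses, coercivity *)

Lemma bf_posdef_ge0 n (A : 'M[R]_n) x : posdef A -> 0 <= bf A x x.
Proof.
move=> [_ pA]; have [->|x0] := eqVneq x 0; first by rewrite bf0l.
exact/ltW/pA.
Qed.

Lemma bf_posdef_eq0 n (A : 'M[R]_n) x : posdef A -> bf A x x <= 0 -> x = 0.
Proof.
by move=> [_ pA] h; apply/eqP/negPn/negP => /pA; rewrite -/(bf A x x) ltNge h.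
Qed.

(** Positivity at [a y - c x], with [a = A[x]], [c = A[x, y]] and [d = A[y]], reads
    [a (a d - c^2) >= 0], and [a > 0] cancels. *)
Lemma bf_CauchySchwarz n (A : 'M[R]_n) x y : posdef A ->
  bf A x y ^+ 2 <= bf A x x * bf A y y.
Proof.
move=> pA; have [->|x0] := eqVneq x 0; first by rewrite !bf0l expr0n mul0r.
have a0 : 0 < bf A x x by apply: pA.2.
have := bf_posdef_ge0 (bf A x x *: y - bf A x y *: x) pA.
rewrite !(bfDl, bfDr, bfNl, bfNr, bfZl, bfZr) (bfC y x pA.1).
set a := bf A x x in a0 *; set c := bf A x y; set d := bf A y y => h.
have {}h : 0 <= a * (a * d - c ^+ 2) by lra.
by move: h; rewrite pmulr_rge0 // subr_ge0.
Qed.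

(** The columns of [cokermx A] are killed by [A], so a trivial kernel makes the cokernel vanish. *)
Lemma unitmx_ker0 n (A : 'M[R]_n) :
  (forall x : 'cV_n, A *m x = 0 -> x = 0) -> A \in unitmx.
Proof.
move=> h; rewrite -row_full_unit -cokermx_eq0; apply/eqP/matrixP => i j.
have /h/matrixP/(_ i 0) : A *m col j (cokermx A) = 0.
  by rewrite colE mulmxA mulmx_coker mul0mx.
by rewrite !mxE.
Qed.

Lemma posdef_unit n (A : 'M[R]_n) : posdef A -> A \in unitmx.
Proof.
move=> pA; apply: unitmx_ker0 => x Ax0; apply: (bf_posdef_eq0 pA).
by rewrite /bf -mulmxA Ax0 mulmx0 mxE.
Qed.

Lemma posdef_invmx n (A : 'M[R]_n) : posdef A -> posdef (invmx A).
Proof.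
move=> pA; have uA := posdef_unit pA; split; first by rewrite trmx_inv pA.1.
move=> x x0; have := pA.2 (invmx A *m x).
rewrite trmx_mul trmx_inv pA.1 mulmxKV // mulmxA; apply.
by apply: contraNneq x0 => h; rewrite -[x](mulKVmx uA) h mulmx0.
Qed.

Lemma bf_bounded n (A : 'M[R]_n) : exists2 C, 0 < C & forall x, bf A x x <= C * sqnorm x.
Proof.
(* The summand 1 keeps the constant positive even when [A = 0]. *)
exists (1 + \sum_j \sum_i `|A i j|).
  by rewrite ltr_pwDl // sumr_ge0 // => j _; apply: sumr_ge0.
move=> x; rewrite mulrDl mul1r ler_wpDl ?sqnorm_ge0 // /bf mxE mulr_suml.
apply: ler_sum => j _; rewrite mxE !mulr_suml; apply: ler_sum => i _; rewrite mxE.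
have sq k : x k 0 ^+ 2 <= sqnorm x.
  by rewrite /sqnorm (bigD1 k) //= lerDl sumr_ge0 // => l _; apply: sqr_ge0.
apply: le_trans (ler_norm _) _; rewrite mulrAC normrM mulrC ler_wpM2l //.
apply: le_trans (_ : (x i 0 ^+ 2 + x j 0 ^+ 2) / 2 <= _); last first.
  by have := sq i; have := sq j; lra.
rewrite ler_norml; apply/andP; split.
- by have := sqr_ge0 (x i 0 + x j 0); nra.
- by have := sqr_ge0 (x i 0 - x j 0); nra.
Qed.

(* [|x|^4 = A[x, A^-1 x]^2 <= A[x] * A^-1[x] <= C A[x] |x|^2] *)
Lemma posdef_coercive n (A : 'M[R]_n) : posdef A ->
  exists2 c, 0 < c & forall x, c * sqnorm x <= bf A x x.
Proof.
move=> pA; have uA := posdef_unit pA.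
have [C C0 hC] := bf_bounded (invmx A); exists C^-1; first by rewrite invr_gt0.
move=> x; have [->|x0] := eqVneq x 0.
  by rewrite bf0l (eqP (_ : sqnorm 0 == 0)) ?sqnorm_eq0 // mulr0.
have := bf_CauchySchwarz x (invmx A *m x) pA.
rewrite bf_mulr mulmxV // bf_scalar mul1r.
have -> : bf A (invmx A *m x) (invmx A *m x) = bf (invmx A) x x.
  by rewrite -bf_congr trmx_inv pA.1 mulVmx // mul1mx.
move=> h; rewrite ler_pdivrMl //.
have s0 : 0 < sqnorm x by rewrite sqnorm_gt0.
rewrite -(ler_pM2r s0) -expr2 (le_trans h) // mulrC [leRHS]mulrAC.
by rewrite ler_wpM2r // bf_posdef_ge0.
Qed.

Lemma posdef_diag2 n1 n2 (A : 'M[R]_n1) (B : 'M[R]_n2) :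
  posdef A -> posdef B -> posdef (diag2 A B).
Proof.
move=> pA pB; split; first by rewrite /diag2 tr_block_mx !trmx0 pA.1 pB.1.
move=> x; rewrite -[x]vsubmxK -/(bf _ _ _) bf_diag2 => x0.
have A0 := bf_posdef_ge0 (usubmx x) pA; have B0 := bf_posdef_ge0 (dsubmx x) pB.
rewrite ltNge; apply: contra x0 => h.
rewrite (bf_posdef_eq0 pA (x := usubmx x)); last by lra.
by rewrite (bf_posdef_eq0 pB (x := dsubmx x)) ?col_mx0 //; lra.
Qed.

Lemma posdef_scalar n (a : R) : 0 < a -> posdef (a%:M : 'M_n).
Proof.
move=> a0; split; first exact: tr_scalar_mx.
by move=> x x0; rewrite -/(bf _ _ _) bf_scalar mulr_gt0 // sqnorm_gt0.
Qed.

Lemma invmx_diag2 n1 n2 (A : 'M[R]_n1) (B : 'M[R]_n2) :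
  posdef A -> posdef B -> invmx (diag2 A B) = diag2 (invmx A) (invmx B).
Proof.
move=> pA pB; apply: invmx_block_diag.
by rewrite -/(diag2 _ _) posdef_unit //; apply: posdef_diag2.
Qed.

(** * Schur complements and symmetric linear systems *)

Lemma bf_block n1 n2 (A : 'M[R]_n1) (B : 'M[R]_(n2, n1)) (C : 'M[R]_n2) x y :
  bf (block_mx A B^T B C) (col_mx x y) (col_mx x y)
  = bf A x x + 2 * (y^T *m B *m x) 0 0 + bf C y y.
Proof.
have D (X Y : 'M[R]_1) : (X + Y) 0 0 = X 0 0 + Y 0 0 by rewrite mxE.
have T : (x^T *m B^T *m y) 0 0 = (y^T *m B *m x) 0 0.
  have <- : (y^T *m B *m x)^T = x^T *m B^T *m y by rewrite !trmx_mul trmxK mulmxA.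
  by rewrite [LHS]mxE.
rewrite {1}/bf tr_col_mx mul_row_block mul_row_col !mulmxDl !D T /bf; ring.
Qed.

(* Evaluate the block form at [y := - C^-1 B x]. *)
Lemma bf_block_Schur n1 n2 (A : 'M[R]_n1) (B : 'M[R]_(n2, n1)) (C : 'M[R]_n2) x :
  posdef C ->
  exists y, bf (block_mx A B^T B C) (col_mx x y) (col_mx x y)
    = bf A x x - bf (invmx C) (B *m x) (B *m x).
Proof.
move=> pC; have uC := posdef_unit pC; exists (- (invmx C *m (B *m x))).
rewrite bf_block bfNl bfNr opprK -(bf_congr C (invmx C)) trmx_inv pC.1 mulVmx // mul1mx.
rewrite linearN /= !mulNmx mxE -mulmxA trmx_mul trmx_inv pC.1 -/(bf _ _ _).
ring.
Qed.

Lemma posdef_Schur n1 n2 (A : 'M[R]_n1) (B : 'M[R]_(n2, n1)) (C : 'M[R]_n2) :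
  posdef C -> posdef (block_mx A B^T B C) ->
  forall x, x != 0 -> bf (invmx C) (B *m x) (B *m x) < bf A x x.
Proof.
move=> pC [_ pB] x x0; have [y hy] := bf_block_Schur A B x pC.
rewrite -subr_gt0 -hy; apply: pB; apply: contraNneq x0.
by rewrite -col_mx0 => /eq_col_mx[->].
Qed.

Lemma possemidef_Schur n1 n2 (A : 'M[R]_n1) (B : 'M[R]_(n2, n1)) (C : 'M[R]_n2) :
  posdef C -> possemidef (block_mx A B^T B C) ->
  forall x, bf (invmx C) (B *m x) (B *m x) <= bf A x x.
Proof.
move=> pC [_ pB] x; have [y hy] := bf_block_Schur A B x pC.
by rewrite -subr_ge0 -hy; apply: pB.
Qed.

(** Fredholm alternative: the range of a symmetric matrix is the orthogonal complement of its
    kernel. It solves first-order conditions whose Hessian may be singular. *)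
Lemma sym_solvable n k (G : 'M[R]_n) (B : 'M[R]_(n, k)) : G^T = G ->
  (forall x : 'cV_n, G *m x = 0 -> B^T *m x = 0) -> exists X, B = G *m X.
Proof.
move=> GT h; have : (B^T <= G)%MS.
  rewrite submxE; apply/eqP/matrixP => i j.
  have /h/matrixP/(_ i 0) : G *m col j (cokermx G) = 0.
    by rewrite colE mulmxA mulmx_coker mul0mx.
  by rewrite colE mulmxA -colE !mxE.
by case/submxP => D hD; exists D^T; rewrite -[B]trmxK hD trmx_mul GT.
Qed.

(** * Block-diagonal multipliers and scheduling blocks *)

Section BlockDiagonal.
Variables (p : nat) (m : 'I_p -> nat).

Lemma bf_bdiag (X : forall i, 'M[R]_(m i)) (x y : 'cV_(\sum_i m i)) :
  bf (bdiag X) x y = \sum_i bf (X i) (submxcol x i) (submxcol y i).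
Proof.
rewrite {1}/bf /bdiag -mulmxA -[x in x^T]submxcolK -[y in LHS]submxcolK mul_mxdiag_mxcol.
rewrite tr_mxcol mul_mxrow_mxcol summxE; apply: eq_bigr => i _.
by rewrite /bf mulmxA.
Qed.

Lemma submxcol_sdiag (dl : 'I_p -> R) (x : 'cV_(\sum_i m i)) i :
  submxcol (sdiag m dl *m x) i = dl i *: submxcol x i.
Proof.
by rewrite /sdiag -[x in LHS]submxcolK mul_mxdiag_mxcol mxcolK mul_scalar_mx.
Qed.

Lemma posdef_bdiag (X : forall i, 'M[R]_(m i)) :
  (forall i, posdef (X i)) -> posdef (bdiag X).
Proof.
move=> pX; split.
  by rewrite /bdiag tr_mxdiag; apply: eq_mxdiag => i; apply: (pX i).1.
move=> x x0; rewrite -/(bf _ _ _) lt_def.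
have h i : 0 <= bf (X i) (submxcol x i) (submxcol x i) by apply: bf_posdef_ge0.
rewrite bf_bdiag sumr_ge0 // andbT; apply: contraNneq x0 => /psumr_eq0P e.
apply/eqP/mxcolP => i; rewrite submxcol0; apply: (bf_posdef_eq0 (pX i)).
by rewrite e.
Qed.

Lemma invmx_bdiag (X : forall i, 'M[R]_(m i)) : (forall i, posdef (X i)) ->
  invmx (bdiag X) = bdiag (fun i => invmx (X i)).
Proof.
move=> pX; have uX := posdef_unit (posdef_bdiag pX).
have e : bdiag X *m bdiag (fun i => invmx (X i)) = 1%:M.
  rewrite /bdiag mul_mxdiag_mxblock -[RHS](@mxdiagZ _ p m 1); apply: eq_mxblock => i j.
  case: eqVneq => [->|]; rewrite ?mulmx0 //.
  by rewrite !conform_mx_id mulmxV ?posdef_unit.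
by rewrite -[LHS]mulmx1 -e mulKmx.
Qed.

(** Each scheduling block is a scalar multiple of the identity, so it only scales the [i]-th summand
    by [dl i ^+ 2 <= 1]. *)
Lemma bdiag_contraction (X : forall i, 'M[R]_(m i)) (dl : 'I_p -> R) x :
  (forall i, posdef (X i)) -> admissible_param dl ->
  bf (bdiag X) (sdiag m dl *m x) (sdiag m dl *m x) <= bf (bdiag X) x x.
Proof.
move=> pX hdl; rewrite !bf_bdiag; apply: ler_sum => i _.
rewrite submxcol_sdiag bfZl bfZr mulrA -expr2.
have : dl i ^+ 2 <= 1 by rewrite -real_normK ?num_real // expr_le1.
by have := bf_posdef_ge0 (submxcol x i) (pX i); nra.
Qed.

End BlockDiagonal.

(** * Quadratic minimisation and the linear saddle point *)

(* The minimiser [u] of [Z^-1[H x + B u]] makes [y := Z^-1 (H x + B u)] lie in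
   [ker B^T = im NR], and the minimum is [y^T H x], to which Cauchy-Schwarz applies. *)
Lemma projected_lmi_feasible ny nx nu r (Y : 'M[R]_nx) (Z : 'M[R]_ny)
    (H : 'M[R]_(ny, nx)) (B : 'M[R]_(ny, nu)) (NR : 'M[R]_(ny, r)) :
  posdef Y -> posdef Z ->
  (forall y : 'cV_ny, B^T *m y = 0 -> exists eta : 'cV_r, y = NR *m eta) ->
  negdef (NR^T *m (H *m Y *m H^T - Z) *m NR) ->
  forall x : 'cV_nx, x != 0 -> exists u : 'cV_nu,
    bf (invmx Z) (H *m x + B *m u) (H *m x + B *m u) < bf (invmx Y) x x.
Proof.
move=> pY pZ hNR [_ neg] x x0; have uZ := posdef_unit pZ; have uY := posdef_unit pY.
have pZi := posdef_invmx pZ; have pYi := posdef_invmx pY.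
(* Normal equation for the minimiser; it is solvable because the kernel of [B^T Z^-1 B] is that of
   [B]. *)
have [u hu] : exists u, - (B^T *m invmx Z *m H *m x) = (B^T *m invmx Z *m B) *m u.
  apply: sym_solvable; first by rewrite !trmx_mul trmxK pZi.1 mulmxA.
  move=> v Gv; have Bv0 : B *m v = 0.
    by apply: (bf_posdef_eq0 pZi); rewrite -bf_congr /bf -mulmxA Gv mulmx0 mxE.
  by rewrite linearN /= !trmx_mul trmxK pZi.1 mulNmx -!mulmxA Bv0 !mulmx0 oppr0.
exists u; set s := H *m x + B *m u; set y := invmx Z *m s.
have By : B^T *m y = 0.
  by rewrite /y /s !mulmxDr !mulmxA -hu subrr.
have vy : bf (invmx Z) s s = bf Z y y.
  by rewrite /y -(bf_congr Z (invmx Z)) pZi.1 mulVmx // mul1mx.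
have [eta yE] := hNR y By.
have vH : bf Z y y = bf Y (H^T *m y) (invmx Y *m x).
  have -> : bf Z y y = (y^T *m s) 0 0 by rewrite /bf -mulmxA /y mulKVmx.
  rewrite /s mulmxDr [y^T *m (B *m u)]mulmxA -[B]trmxK -trmx_mul By trmx0 mul0mx addr0.
  by rewrite bf_mulr mulmxV // /bf [(H^T *m y)^T]trmx_mul trmxK mulmx1 mulmxA.
have x_gt0 : 0 < bf (invmx Y) x x by apply: pYi.2.
rewrite vy; have [y0|y0] := eqVneq y 0; first by rewrite y0 bf0l.
have Zy_gt0 : 0 < bf Z y y by apply: pZ.2.
(* This bounds [Z[y]^2] by [Y[H^T y] * Y^-1[x]]; the projected inequality gives [Y[H^T y] < Z[y]],
   and one factor [Z[y]] cancels. *)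
have CS := bf_CauchySchwarz (H^T *m y) (invmx Y *m x) pY.
rewrite -vH -[bf Y (invmx Y *m x) _]bf_congr pYi.1 mulVmx // mul1mx in CS.
have lt : bf Y (H^T *m y) (H^T *m y) < bf Z y y.
  have eta0 : eta != 0 by apply: contraNneq y0 => e; rewrite yE e mulmx0.
  have := neg _ eta0; rewrite -/(bf _ _ _) bf_oppm bf_congr -yE bf_addm bf_oppm.
  have <- : bf (H *m Y *m H^T) y y = bf Y (H^T *m y) (H^T *m y).
    by rewrite -bf_congr trmxK.
  by lra.
rewrite -(ltr_pM2l Zy_gt0) -expr2; apply: le_lt_trans CS _.
by rewrite ltr_pM2r.
Qed.

(* The strict game [min over v, max over w] of the quadratic [Pi[y] - Om[q]] is strongly
   concave in [w] and convex in [v], hence its first-order conditions have a solution that is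
   linear in [a]; the [v]-part of this saddle point is the gain [K]. *)
Lemma linear_saddle_point na nw nv ny nq
    (M1 : 'M[R]_(ny, na)) (M2 : 'M[R]_(ny, nw)) (M3 : 'M[R]_(ny, nv)) (Pi : 'M[R]_ny)
    (L1 : 'M[R]_(nq, na)) (L2 : 'M[R]_(nq, nw)) (Om : 'M[R]_nq) :
  posdef Pi -> Om^T = Om ->
  (forall w : 'cV_nw, w != 0 ->
     bf Pi (M2 *m w) (M2 *m w) < bf Om (L2 *m w) (L2 *m w)) ->
  (forall (a : 'cV_na) (w : 'cV_nw), a != 0 -> exists v : 'cV_nv,
     let y := M1 *m a + M2 *m w + M3 *m v in let q := L1 *m a + L2 *m w in
     bf Pi y y < bf Om q q) ->
  exists (K : 'M[R]_(nv, na)) (c : R), 0 < c /\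
    forall (a : 'cV_na) (w : 'cV_nw),
     let y := M1 *m a + M2 *m w + M3 *m (K *m a) in let q := L1 *m a + L2 *m w in
     bf Pi y y + c * (sqnorm a + sqnorm w) <= bf Om q q.
Proof.
move=> pPi sOm hw ha.
(* [E] and [F] carry the dependence of [y] and [q] on [(w, v)]; [v] does not enter [q]. The form [G]
   is then half the Hessian of the game in [(w, v)]. *)
pose E := row_mx M2 M3; pose F : 'M_(nq, nw + nv) := row_mx L2 0.
have Ecol w v : E *m col_mx w v = M2 *m w + M3 *m v by rewrite mul_row_col.
have Fcol w v : F *m col_mx w v = L2 *m w by rewrite mul_row_col mul0mx addr0.
pose G := E^T *m Pi *m E - F^T *m Om *m F.
have GT : G^T = G by rewrite /G linearB /= !trmx_mul !trmxK pPi.1 sOm !mulmxA.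
have bfG x x' : (x^T *m (G *m x')) 0 0 = bf Pi (E *m x) (E *m x') - bf Om (F *m x) (F *m x').
  by rewrite -!bf_congr -bf_oppm -bf_addm /bf mulmxA.
have [X hX] : exists X, - (E^T *m Pi *m M1 - F^T *m Om *m L1) = G *m X.
  apply: sym_solvable => // x Gx0.
  have [w [v xE]] : exists w v, x = col_mx w v.
    by exists (usubmx x), (dsubmx x); rewrite vsubmxK.
  (* Testing a kernel vector against [(w, 0)] and [(0, v)] and subtracting gives [Pi[M2 w] -
     Om[L2 w] = Pi[M3 v] >= 0]. Concavity forces [w = 0], and then [M3 v = 0]. *)
  have := bfG (col_mx w 0) x; have := bfG (col_mx 0 v) x.
  rewrite Gx0 xE !mulmx0 mxE !Ecol !Fcol !mulmx0 addr0 add0r bf0l !bfDr.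
  rewrite (bfC (M3 *m v) (M2 *m w) pPi.1) => e1 e2.
  have v0 := bf_posdef_ge0 (M3 *m v) pPi.
  have w0 : w = 0.
    by apply/eqP/negPn/negP => /hw; lra.
  have Mv0 : M3 *m v = 0.
    by apply: (bf_posdef_eq0 pPi); move: e1; rewrite w0 mulmx0 bf0l; lra.
  have Ex0 : E *m col_mx w v = 0 by rewrite Ecol w0 Mv0 mulmx0 addr0.
  have Fx0 : F *m col_mx w v = 0 by rewrite Fcol w0 mulmx0.
  rewrite linearN linearB /= !trmx_mul !trmxK pPi.1 sOm mulNmx mulmxBl.
  by rewrite -!mulmxA Ex0 Fx0 !mulmx0 subrr oppr0.
have swap k (u1 u2 u3 : 'cV[R]_k) : u1 + u3 = u1 + u2 + (u3 - u2).
  by rewrite -addrA [u2 + _]addrC subrK.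
pose W := usubmx X; pose K := dsubmx X.
have XE a : X *m a = col_mx (W *m a) (K *m a) by rewrite -mul_col_mx vsubmxK.
have [y0 y0E] : exists y0 : 'cV_na -> 'cV_ny,
    forall a, y0 a = M1 *m a + M2 *m (W *m a) + M3 *m (K *m a) by eexists.
have [q0 q0E] : exists q0 : 'cV_na -> 'cV_nq,
    forall a, q0 a = L1 *m a + L2 *m (W *m a) by eexists.
(* Stationarity: at the saddle point [(W a, K a)] the derivative in every direction [x] of [(w, v)]
   vanishes. *)
have stat a x : bf Pi (E *m x) (y0 a) = bf Om (F *m x) (q0 a).
  have -> : y0 a = M1 *m a + E *m (X *m a) by rewrite XE Ecol addrA y0E.
  have -> : q0 a = L1 *m a + F *m (X *m a) by rewrite XE Fcol q0E.
  have := bfG x (X *m a); rewrite [G *m _]mulmxA -hX.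
  rewrite mulNmx mulmxBl mulmxN mulmxBr mxE [X in - X]mxE [X in - (_ + X)]mxE.
  have -> : (x^T *m (E^T *m Pi *m M1 *m a)) 0 0 = bf Pi (E *m x) (M1 *m a).
    by rewrite /bf trmx_mul !mulmxA.
  have -> : (x^T *m (F^T *m Om *m L1 *m a)) 0 0 = bf Om (F *m x) (L1 *m a).
    by rewrite /bf trmx_mul !mulmxA.
  by rewrite !bfDr; lra.
(* Moving from [K a] to the [v] supplied by [ha] only adds [Pi[M3 (v - K a)] >= 0], since [stat]
   removes the cross term. *)
have neg a : a != 0 -> bf Pi (y0 a) (y0 a) < bf Om (q0 a) (q0 a).
  move=> /(ha a (W *m a))[v] /=; set y := (X in bf Pi X X) => lt.
  have yE : y = y0 a + M3 *m (v - K *m a) by rewrite /y y0E mulmxBr; exact: swap.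
  have := stat a (col_mx 0 (v - K *m a)).
  rewrite Ecol Fcol !mulmx0 add0r bf0l => s0.
  move: lt; rewrite yE -q0E !(bfDl, bfDr) (bfC (y0 a) _ pPi.1) s0.
  by have := bf_posdef_ge0 (M3 *m (v - K *m a)) pPi; lra.
pose E' := row_mx (M1 + M3 *m K) M2; pose F' := row_mx L1 L2.
have E'col a w : E' *m col_mx a w = M1 *m a + M2 *m w + M3 *m (K *m a).
  by rewrite mul_row_col mulmxDl addrAC mulmxA.
have F'col a w : F' *m col_mx a w = L1 *m a + L2 *m w by rewrite mul_row_col.
(* With the gain [K] fixed, [Th] is the margin as a form in [(a, w)]. Centring [w] at [W a] removes
   the cross terms and leaves the saddle value plus the concave part in [w - W a]. *)
pose Th := F'^T *m Om *m F' - E'^T *m Pi *m E'.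
have bfTh x : bf Th x x = bf Om (F' *m x) (F' *m x) - bf Pi (E' *m x) (E' *m x).
  by rewrite bf_addm bf_oppm !bf_congr.
have pTh : posdef Th.
  split; first by rewrite /Th linearB /= !trmx_mul !trmxK pPi.1 sOm !mulmxA.
  move=> x; rewrite -[x]vsubmxK -/(bf _ _ _) bfTh E'col F'col.
  set a := usubmx x; set w := dsubmx x; rewrite subr_gt0 => aw0.
  have -> : M1 *m a + M2 *m w + M3 *m (K *m a) = y0 a + M2 *m (w - W *m a).
    by rewrite y0E mulmxBr addrAC [M1 *m a + M2 *m (W *m a) + _]addrAC; exact: swap.
  have -> : L1 *m a + L2 *m w = q0 a + L2 *m (w - W *m a).
    by rewrite q0E mulmxBr; exact: swap.
  have := stat a (col_mx (w - W *m a) 0).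
  rewrite Ecol Fcol !mulmx0 addr0 !(bfDl, bfDr) => s0.
  rewrite (bfC (y0 a) _ pPi.1) (bfC (q0 a) _ sOm) s0.
  have [a0|/neg lt] := eqVneq a 0; last first.
    have [->|/hw] := eqVneq (w - W *m a) 0; last by lra.
    by rewrite !mulmx0 !bf0l; lra.
  have w0 : w != 0 by apply: contraNneq aw0 => w0; rewrite a0 w0 col_mx0.
  rewrite y0E q0E a0 !mulmx0 !addr0 !bf0r subr0 !add0r; exact: hw.
have [c c0 hc] := posdef_coercive pTh.
exists K, c; split=> // a w /=.
by have := hc (col_mx a w); rewrite bfTh sqnorm_col E'col F'col; lra.
Qed.

(** * Inverse bounds from coupling inequalities, and linear fixed points *)

(** The block form at [(- X^-1 x, x)] equals [Y[x] - X^-1[x]]. *)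
Lemma possemidef_inv_le k (X Y : 'M[R]_k) : posdef X ->
  possemidef (block_mx X 1%:M 1%:M Y) -> forall x, bf (invmx X) x x <= bf Y x x.
Proof.
move=> pX [_ h] x; have uX := posdef_unit pX.
have := h (col_mx (- (invmx X *m x)) x); rewrite -/(bf _ _ _).
rewrite -[X in block_mx _ X]tr_scalar_mx bf_block mulmx1 mulmxN mxE bfNl bfNr opprK.
rewrite -(bf_congr X (invmx X)) trmx_inv pX.1 mulVmx // mul1mx mulmxA -/(bf _ _ _).
by lra.
Qed.

Lemma invr_le_block (x y : R) : 0 < x ->
  possemidef (block_mx (x%:M : 'M_1) 1%:M 1%:M (y%:M : 'M_1)) -> x^-1 <= y.
Proof.
move=> x0 /(possemidef_inv_le (posdef_scalar 1 x0)) /(_ (const_mx 1)).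
rewrite invmx_scalar !bf_scalar ler_pM2r // sqnorm_gt0.
by apply/eqP => /matrixP/(_ 0 0)/eqP; rewrite !mxE oner_eq0.
Qed.

(** The hypothesis says that [1 - D A] is injective, hence invertible. *)
Lemma affine_fixpoint k (D A : 'M[R]_k) (v : 'cV_k) :
  (forall x : 'cV_k, x = D *m (A *m x) -> x = 0) ->
  exists x0, forall x, x = D *m (A *m x + v) <-> x = x0.
Proof.
move=> ker; have uE : 1%:M - D *m A \in unitmx.
  apply: unitmx_ker0 => x; rewrite mulmxBl mul1mx -mulmxA => /eqP.
  by rewrite subr_eq0 => /eqP/ker.
have E (x : 'cV_k) : (1%:M - D *m A) *m x = x - D *m (A *m x).
  by rewrite mulmxBl mul1mx mulmxA.
exists (invmx (1%:M - D *m A) *m (D *m v)) => x; split=> [xE|->].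
  have {1}<- : (1%:M - D *m A) *m x = D *m v.
    by rewrite E {1}xE mulmxDr addrC addKr.
  by rewrite mulKmx.
set x0 := invmx _ *m _; rewrite mulmxDr; apply/eqP; rewrite addrC -subr_eq -E.
by rewrite /x0 mulKVmx.
Qed.

(** * Controller synthesis, dissipation and well-posedness of the closed loop *)

Section ClosedLoop.
Variables (n Nb p : nat) (m : 'I_p -> nat) (nd nu ne : nat).
Local Notation N := (n + Nb)%N.
Local Notation M := (\sum_i m i)%N.
Variable G : plant R n Nb m nd nu ne.

(** Rows of [K] split as [(u, phc)] and columns as [(z, thc)]. The controller takes the block sizes
    [m] of the plant, so both scheduling channels pass through the same [sdiag m dl]. *)
Definition gain_ctrl (K : 'M[R]_(nu + M, N + M)) : sctrl R p N nu :=
  @SCtrl R p N nu m (drsubmx K) (dlsubmx K) (ursubmx K) (ulsubmx K).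

(* Dissipation for arbitrary [th] and [thc]: neither the scheduling blocks
   [th = Delta ph] and [thc = Delta phc] nor their bounds are used yet. *)
Definition dissipative (P Pn : 'M[R]_N) (b f2 : R) (K : 'M[R]_(nu + M, N + M)) :=
  exists (Q T : forall i, 'M[R]_(m i)) (c : R),
  [/\ forall i, posdef (Q i), forall i, posdef (T i), 0 < c &
    forall z th thc d,
    let u := ursubmx K *m thc + ulsubmx K *m z in
    let phc := drsubmx K *m thc + dlsubmx K *m z in
    let ph := Aps G *m z + App G *m th + B1p G *m d + B2p G *m u in
    let zn := Ass G *m z + Asp G *m th + B1s G *m d + B2s G *m u in
    let e := C1s G *m z + C1p G *m th + D11 G *m d + D12 G *m u in
    bf Pn zn zn + bf (bdiag Q) ph ph + bf (bdiag T) (ph - phc) (ph - phc)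
      + b^-1 * sqnorm e + c * (sqnorm z + sqnorm th + sqnorm thc)
    <= bf P z z + bf (bdiag Q) th th + bf (bdiag T) (th - thc) (th - thc)
      + f2 * sqnorm d].

(** [Pz] and [Rn] stand for [R0(k)] and [R0(k+1)]; their inverses are the storage matrices. The
    proof checks the two hypotheses of [linear_saddle_point]: concavity in [(th, d)], and a winning
    reply [(u, phc)] to each [(z, thc, th, d)]. *)
Lemma exists_dissipative (Pz Rn : 'M[R]_N) (Rs Ss : forall i, 'M[R]_(m i))
    (b f2 g t : R) (r : nat) (NR : 'M[R]_(N + (M + ne), r)) :
  posdef Pz -> posdef Rn -> (forall i, posdef (Rs i)) -> (forall i, posdef (Ss i)) ->
  0 < b -> 0 < f2 -> 0 < g -> 0 < t ->
  (forall x : 'cV[R]_(N + (M + ne)),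
     row_mx (B2s G)^T (row_mx (B2p G)^T (D12 G)^T) *m x = 0 ->
     exists y : 'cV[R]_r, x = NR *m y) ->
  let H12 := row_mx (Asp G) (B1s G) in
  let H22 := block_mx (App G) (B1p G) (C1p G) (D11 G) in
  let H := block_mx (Ass G) H12 (col_mx (Aps G) (C1s G)) H22 in
  negdef (NR^T *m
    (H *m diag2 Pz (diag2 (bdiag Rs) (g%:M : 'M[R]_nd)) *m H^T
     - diag2 Rn (diag2 (bdiag Rs) (b%:M : 'M[R]_ne))) *m NR) ->
  posdef (block_mx
    (diag2 (bdiag Ss) (f2%:M : 'M[R]_nd)
       - H22^T *m diag2 (bdiag Ss) (t%:M : 'M[R]_ne) *m H22)
    H12^T H12 Rn) ->
  (forall i, possemidef (block_mx (Rs i) 1%:M 1%:M (Ss i))) ->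
  g^-1 <= f2 -> b^-1 <= t ->
  exists K, dissipative (invmx Pz) (invmx Rn) b f2 K.
Proof.
move=> pP pRn pR pS b0 f20 g0 t0 hNR H12 H22 H lmiR lmiS RS gf bt.
have pPi := posdef_invmx pP; have pRni := posdef_invmx pRn.
have pSd := posdef_bdiag pS; have pRd := posdef_bdiag pR.
pose Q i := invmx (Rs i).
have pQ i : posdef (Q i) by apply: posdef_invmx.
have pQd := posdef_bdiag pQ.
(* The Schur complement of the strict inequality has a coercivity constant [c], and [C] bounds
   [sqnorm ph]; [eps = c / (2 C)] spends half of that margin. The weight [t] on [e] drops to [b^-1]
   by [bt]. *)
have [eps eps0 Sstrict] : exists2 eps, 0 < eps &
    forall (th : 'cV_M) (d : 'cV_nd), col_mx th d != 0 ->
    let ph := App G *m th + B1p G *m d in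
    let zn := Asp G *m th + B1s G *m d in
    let e := C1p G *m th + D11 G *m d in
    bf (invmx Rn) zn zn + bf (bdiag Ss) ph ph + eps * sqnorm ph + b^-1 * sqnorm e
    < bf (bdiag Ss) th th + f2 * sqnorm d.
  have Schur := posdef_Schur pRn lmiS.
  have sym22 : (diag2 (bdiag Ss) (f2%:M : 'M[R]_nd)
       - H22^T *m diag2 (bdiag Ss) (t%:M : 'M[R]_ne) *m H22)^T =
     diag2 (bdiag Ss) (f2%:M : 'M[R]_nd)
       - H22^T *m diag2 (bdiag Ss) (t%:M : 'M[R]_ne) *m H22.
    rewrite linearB /= !trmx_mul trmxK (posdef_diag2 pSd (posdef_scalar ne t0)).1.
    by rewrite (posdef_diag2 pSd (posdef_scalar nd f20)).1 mulmxA.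
  set D := (X in X^T = X) in sym22 Schur.
  have pW : posdef (D - H12^T *m invmx Rn *m H12).
    split; first by rewrite linearB /= sym22 !trmx_mul trmxK pRni.1 mulmxA.
    by move=> x x0; rewrite -/(bf _ _ _) bf_addm bf_oppm bf_congr subr_gt0; apply: Schur.
  have [c c0 hc] := posdef_coercive pW.
  have [C C0 hC] := bf_bounded ((row_mx (App G) (B1p G))^T *m 1%:M *m row_mx (App G) (B1p G)).
  exists (c / (2 * C)); first by rewrite divr_gt0 // mulr_gt0.
  move=> th d x0 /=; set ph := App G *m th + _; set zn := Asp G *m th + _.
  set e := C1p G *m th + _.
  have := hC (col_mx th d); rewrite bf_congr bf_scalar mul1r mul_row_col -/ph => h1.
  have := hc (col_mx th d); rewrite bf_addm bf_oppm bf_congr mul_row_col -/zn.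
  rewrite /D bf_addm bf_oppm bf_congr !bf_diag2 mul_block_col !bf_diag2 -/ph -/e !bf_scalar => h2.
  have h3 : c / (2 * C) * sqnorm ph <= c / 2 * sqnorm (col_mx th d).
    rewrite invfM mulrA -mulrA ler_wpM2l //; first by rewrite divr_ge0 // ltW.
    by rewrite ler_pdivrMl.
  have h4 : 0 < c * sqnorm (col_mx th d) by rewrite mulr_gt0 // sqnorm_gt0.
  have h5 := ler_wpM2r (sqnorm_ge0 e) bt.
  by lra.
(* [Ss i - Q i] is only semidefinite; adding [eps] makes [T i] definite, and [Q + T] equals
   [S + eps]. *)
pose T i := Ss i - Q i + eps%:M.
have pT i : posdef (T i).
  split; first by rewrite /T linearD linearB /= (pS i).1 (pQ i).1 tr_scalar_mx.
  move=> x x0; rewrite -/(bf _ _ _) /T !bf_addm bf_oppm bf_scalar.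
  have := possemidef_inv_le (pR i) (RS i) x.
  by have : 0 < eps * sqnorm x; [rewrite mulr_gt0 // sqnorm_gt0|rewrite /Q; lra].
have pTd := posdef_bdiag pT.
have QT x : bf (bdiag Q) x x + bf (bdiag T) x x = bf (bdiag Ss) x x + eps * sqnorm x.
  rewrite -bf_scalar -[in RHS](@mxdiagZ _ p m eps) -/(bdiag _) !bf_bdiag -!big_split /=.
  by apply: eq_bigr => i _; rewrite /T !bf_addm bf_oppm; lra.
have bi0 : 0 < b^-1 by rewrite invr_gt0.
(* Game data: [y = (zn, ph, ph - phc, e)] and [q = (z, th, th - thc, d)], with known [a = (z, thc)],
   hidden [w = (th, d)] and control [v = (u, phc)]. *)
pose M1 : 'M[R]_(N + (M + (M + ne)), N + M) := col_mx (row_mx (Ass G) 0)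
  (col_mx (row_mx (Aps G) 0) (col_mx (row_mx (Aps G) 0) (row_mx (C1s G) 0))).
pose M2 : 'M[R]_(N + (M + (M + ne)), M + nd) := col_mx (row_mx (Asp G) (B1s G))
  (col_mx (row_mx (App G) (B1p G)) (col_mx (row_mx (App G) (B1p G)) (row_mx (C1p G) (D11 G)))).
pose M3 : 'M[R]_(N + (M + (M + ne)), nu + M) := col_mx (row_mx (B2s G) 0)
  (col_mx (row_mx (B2p G) 0) (col_mx (row_mx (B2p G) (- 1%:M)) (row_mx (D12 G) 0))).
pose L1 : 'M[R]_(N + (M + (M + nd)), N + M) := col_mx (row_mx 1%:M 0)
  (col_mx 0 (col_mx (row_mx 0 (- 1%:M)) 0)).
pose L2 : 'M[R]_(N + (M + (M + nd)), M + nd) := col_mx 0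
  (col_mx (row_mx 1%:M 0) (col_mx (row_mx 1%:M 0) (row_mx 0 1%:M))).
pose Pi := diag2 (invmx Rn) (diag2 (bdiag Q) (diag2 (bdiag T) (b^-1%:M : 'M_ne))).
pose Om := diag2 (invmx Pz) (diag2 (bdiag Q) (diag2 (bdiag T) (f2%:M : 'M_nd))).
have M1E z thc : M1 *m col_mx z thc =
    col_mx (Ass G *m z) (col_mx (Aps G *m z) (col_mx (Aps G *m z) (C1s G *m z))).
  by rewrite /M1 !mul_col_mx !mul_row_col !mul0mx !addr0.
have M2E th d : M2 *m col_mx th d = col_mx (Asp G *m th + B1s G *m d)
    (col_mx (App G *m th + B1p G *m d) (col_mx (App G *m th + B1p G *m d)
      (C1p G *m th + D11 G *m d))).
  by rewrite /M2 !mul_col_mx !mul_row_col.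
have M3E u phc : M3 *m col_mx u phc =
    col_mx (B2s G *m u) (col_mx (B2p G *m u) (col_mx (B2p G *m u - phc) (D12 G *m u))).
  by rewrite /M3 !mul_col_mx !mul_row_col !mul0mx !addr0 mulNmx mul1mx.
have L1E z thc : L1 *m col_mx z thc = col_mx z (col_mx 0 (col_mx (- thc) 0)).
  by rewrite /L1 !mul_col_mx !mul_row_col !mul0mx mul1mx mulNmx mul1mx addr0 add0r.
have L2E th d : L2 *m col_mx th d = col_mx 0 (col_mx th (col_mx th d)).
  by rewrite /L2 !mul_col_mx !mul_row_col !mul0mx !mul1mx !addr0 add0r.
have pPi' : posdef Pi by do !apply: posdef_diag2 => //; apply: posdef_scalar.
have pOm : posdef Om by do !apply: posdef_diag2 => //; apply: posdef_scalar.
have [||K [c [c0 hK]]] := linear_saddle_point (M1 := M1) (M2 := M2) (M3 := M3) (L1 := L1)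
    (L2 := L2) pPi' pOm.1.
(* With [a = 0] and [v = 0] the second and third components agree in [y] and in [q], so the weights
   [Q] and [T] add up to [S + eps]. *)
- move=> w; rewrite -[w]vsubmxK; set th := usubmx w; set d := dsubmx w => x0.
  rewrite M2E L2E !bf_diag2 !bf_scalar bf0l.
  have := Sstrict th d x0; rewrite /=; have := QT th; have := QT (App G *m th + B1p G *m d).
  by have : 0 <= eps * sqnorm th; [rewrite mulr_ge0 ?sqnorm_ge0 // ltW|lra].
- move=> a w; rewrite -[a]vsubmxK -[w]vsubmxK.
  set z := usubmx a; set thc := dsubmx a; set th := usubmx w; set d := dsubmx w => a0.
  rewrite M1E M2E L1E L2E.
  (* If [z], [th] and [d] all vanish, then [thc] does not; the reply [0] gives [y = 0], while [q]
     still contributes [T[- thc] > 0]. *)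
  have [x0|x0] := eqVneq (col_mx z (col_mx th d)) 0.
    move: x0; rewrite -[RHS]col_mx0 => /eq_col_mx[z0].
    rewrite -[RHS]col_mx0 => /eq_col_mx[th0 d0].
    exists 0; rewrite /= z0 th0 d0 !mulmx0 !col_mx0 !addr0.
    rewrite !bf_diag2 !bf0l !addr0 !add0r !col_mx0 bf0l; apply: pTd.2; rewrite oppr_eq0.
    by apply: contraNneq a0 => ->; rewrite z0 col_mx0.
  pose B := col_mx (B2s G) (col_mx (B2p G) (D12 G)).
  have BT : B^T = row_mx (B2s G)^T (row_mx (B2p G)^T (D12 G)^T) by rewrite !tr_col_mx.
  rewrite -BT in hNR.
  have [u] := projected_lmi_feasible (posdef_diag2 pP (posdef_diag2 pRd (posdef_scalar nd g0)))
    (posdef_diag2 pRn (posdef_diag2 pRd (posdef_scalar ne b0))) hNR lmiR x0.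
  have psc k (x : R) : 0 < x -> posdef (x%:M : 'M_k) by apply: posdef_scalar.
  do ![rewrite invmx_diag2 //; last by do ?apply: posdef_diag2 => //; apply: psc].
  rewrite !invmx_scalar !invmx_bdiag // -/Q.
  rewrite mul_block_col mul_row_col mul_col_mx mul_block_col add_col_mx.
  rewrite !mul_col_mx !add_col_mx !bf_diag2 !bf_scalar => hu.
  (* The reply [phc = ph] removes the [T] term from [y]; the weight [g^-1] on [d] is then raised to
     [f2]. *)
  exists (col_mx u (Aps G *m z + (App G *m th + B1p G *m d) + B2p G *m u)).
  rewrite M3E !add_col_mx /= !bf_diag2 !bf_scalar !addr0 !add0r.
  rewrite [_ + (B2p G *m u - _)]addrA subrr bf0l.
  have := bf_posdef_ge0 (- thc + th) pTd.
  have := ler_wpM2r (sqnorm_ge0 d) gf.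
  by lra.
exists K, Q, T, c; split=> // z th thc d /=.
set u := ursubmx K *m thc + _; set phc := drsubmx K *m thc + _.
set ph := Aps G *m z + _ + _ + _; set zn := Ass G *m z + _ + _ + _.
set e := C1s G *m z + _ + _ + _.
have := hK (col_mx z thc) (col_mx th d).
have -> : K *m col_mx z thc = col_mx u phc.
  by rewrite -[K]submxK mul_block_col /u /phc ![_ *m z + _]addrC.
rewrite M1E M2E M3E L1E L2E /= !add_col_mx !bf_diag2 !bf_scalar !sqnorm_col.
rewrite !addr0 !add0r !addrA -/zn -/ph -/e ![- thc + _]addrC.
have : 0 <= c * sqnorm d by rewrite mulr_ge0 ?sqnorm_ge0 // ltW.
by lra.
Qed.

(** Plant and controller see the same scheduling block, so [th - thc] is the image of [ph - phc] and
    both multiplier terms contract. *)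
Lemma dissipative_step P Pn b f2 K : dissipative P Pn b f2 K ->
  C2s G = 1%:M -> C2p G = 0 -> D21 G = 0 ->
  exists2 c, 0 < c & forall dl z d th ph u y thc phc, admissible_param dl ->
    @alg_eqs R n Nb p m nd nu ne G (gain_ctrl K) dl z d th ph u y thc phc ->
    let zn := Ass G *m z + Asp G *m th + B1s G *m d + B2s G *m u in
    let e := C1s G *m z + C1p G *m th + D11 G *m d + D12 G *m u in
    bf Pn zn zn + b^-1 * sqnorm e + c * (sqnorm z + sqnorm th + sqnorm thc)
      <= bf P z z + f2 * sqnorm d.
Proof.
move=> [Q [T [c [pQ pT c0 hK]]]] C2s1 C2p0 D210; exists c => //.
move=> dl z d th ph u y thc phc hdl [[phE yE thE] [phcE uE thcE]] /=.
move: yE; rewrite C2s1 C2p0 D210 mul1mx !mul0mx !addr0 => yE.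
rewrite /= yE in uE phcE; have := hK z th thc d; rewrite /= -uE -phcE -phE.
have := bdiag_contraction ph pQ hdl; rewrite -thE.
have := bdiag_contraction (ph - phc) pT hdl; rewrite mulmxBr -thE -thcE.
by lra.
Qed.

(** The loop equations reduce to an affine fixed point in [(th, thc)]. A homogeneous solution is a
    loop solution with [z = 0] and [d = 0], and there dissipation leaves
    [c (|th|^2 + |thc|^2) <= 0]. *)
Lemma dissipative_wellposed P Pn b f2 K : dissipative P Pn b f2 K ->
  posdef Pn -> 0 < b -> C2s G = 1%:M -> C2p G = 0 -> D21 G = 0 ->
  forall dl, admissible_param dl -> forall z d,
    exists! x : 'cV[R]_M * 'cV[R]_M * 'cV[R]_nu * 'cV[R]_N * 'cV[R]_M * 'cV[R]_M,
      @alg_eqs R n Nb p m nd nu ne G (gain_ctrl K) dl z d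
        x.1.1.1.1.1 x.1.1.1.1.2 x.1.1.1.2 x.1.1.2 x.1.2 x.2.
Proof.
move=> dK pPn b0 C2s1 C2p0 D210 dl hdl z d.
have [c c0 step] := dissipative_step dK C2s1 C2p0 D210.
pose Ac := drsubmx K; pose Bc := dlsubmx K; pose Cc := ursubmx K; pose Dc := ulsubmx K.
pose S := sdiag m dl.
pose phf (z : 'cV_N) (d : 'cV_nd) (th thc : 'cV_M) : 'cV_M :=
  Aps G *m z + App G *m th + B1p G *m d + B2p G *m (Cc *m thc + Dc *m z).
have algE z' d' th ph u y (thc phc : 'cV_M) :
    @alg_eqs R n Nb p m nd nu ne G (gain_ctrl K) dl z' d' th ph u y thc phc <->
    [/\ ph = phf z' d' th thc, u = Cc *m thc + Dc *m z', y = z',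
        phc = Ac *m thc + Bc *m z' &
        th = S *m phf z' d' th thc /\ thc = S *m (Ac *m thc + Bc *m z')].
  rewrite /alg_eqs /= C2s1 C2p0 D210 mul1mx !mul0mx !addr0 -/S -/Ac -/Bc -/Cc -/Dc.
  split=> [[[phE yE thE] [phcE uE thcE]]|[phE uE yE phcE [thE thcE]]].
    by rewrite /phf -[in Dc *m _]yE -[in Bc *m _]yE -uE -phcE -phE.
  by rewrite yE phE phcE uE; split; split.
pose A2 := block_mx (App G) (B2p G *m Cc) 0 Ac.
pose k2 (z : 'cV_N) (d : 'cV_nd) :=
  col_mx (Aps G *m z + B1p G *m d + B2p G *m (Dc *m z)) (Bc *m z).
have fixE z' d' (th thc : 'cV_M) :
    (th = S *m phf z' d' th thc /\ thc = S *m (Ac *m thc + Bc *m z')) <->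
    col_mx th thc = diag2 S S *m (A2 *m col_mx th thc + k2 z' d').
  rewrite /A2 /k2 /diag2 mul_block_col add_col_mx mul_block_col !mul0mx !add0r addr0.
  have -> : App G *m th + B2p G *m Cc *m thc
      + (Aps G *m z' + B1p G *m d' + B2p G *m (Dc *m z')) = phf z' d' th thc.
    have swap (v1 v2 v3 v4 v5 : 'cV[R]_M) :
        v1 + v2 + (v3 + v4 + v5) = v3 + v1 + v4 + (v2 + v5).
      by apply/matrixP => i j; rewrite !mxE; ring.
    by rewrite /phf mulmxDr -mulmxA swap.
  by split=> [[<- <-]|/eq_col_mx].
have ker (x : 'cV_(M + M)) : x = diag2 S S *m (A2 *m x) -> x = 0.
  rewrite -[x]vsubmxK; set th := usubmx x; set thc := dsubmx x => xE.
  have k0 : k2 0 0 = 0 by rewrite /k2 !mulmx0 !addr0 col_mx0.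
  move: xE; rewrite -[X in _ *m X]addr0 -[X in _ *m (_ + X)]k0 => /fixE fx.
  have /algE : [/\ phf 0 0 th thc = phf 0 0 th thc,
     Cc *m thc + Dc *m 0 = Cc *m thc + Dc *m 0, 0 = 0 :> 'cV[R]_N,
     Ac *m thc + Bc *m 0 = Ac *m thc + Bc *m 0 &
     th = S *m phf 0 0 th thc /\ thc = S *m (Ac *m thc + Bc *m 0)] by split.
  move=> /(step _ _ _ _ _ _ _ _ _ hdl) /=; set zn := (X in bf Pn X X).
  set e := (X in b^-1 * sqnorm X); rewrite bf0l.
  have -> : sqnorm (0 : 'cV[R]_nd) = 0 by apply/eqP; rewrite sqnorm_eq0.
  have -> : sqnorm (0 : 'cV[R]_N) = 0 by apply/eqP; rewrite sqnorm_eq0.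
  have : 0 <= b^-1 * sqnorm e by rewrite mulr_ge0 ?sqnorm_ge0 // invr_ge0 ltW.
  have := bf_posdef_ge0 zn pPn => h1 h2 h3.
  have : c * sqnorm (col_mx th thc) <= 0 by rewrite sqnorm_col; lra.
  by rewrite pmulr_rle0 // => s0; apply/eqP; rewrite -sqnorm_eq0 eq_le s0 sqnorm_ge0.
have [x0 hx0] := affine_fixpoint (k2 z d) ker.
pose th := usubmx x0; pose thc := dsubmx x0.
exists (th, phf z d th thc, Cc *m thc + Dc *m z, z, thc, Ac *m thc + Bc *m z); split=> /=.
  by apply/algE; split=> //; apply/fixE/hx0; rewrite vsubmxK.
move=> [[[[[th' ph'] u'] y'] thc'] phc'] /= /algE[-> -> -> -> /fixE/hx0 xE].
by rewrite /th /thc -xE col_mxKu col_mxKd.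
Qed.

End ClosedLoop.

(** * Uniform constants, Lyapunov decay, energy summation and the initial storage *)

Lemma uniform_le (Pr : nat -> R -> Prop) (h : nat) :
  (forall k c c', 0 < c' -> c' <= c -> Pr k c -> Pr k c') ->
  (forall k, (k <= h)%N -> exists2 c, 0 < c & Pr k c) ->
  exists2 c, 0 < c & forall k, (k <= h)%N -> Pr k c.
Proof.
move=> mono; elim: h => [|h IH] hP.
  by have [c c0 hc] := hP 0%N isT; exists c => // k; rewrite leqn0 => /eqP ->.
have [k /leqW/hP//|c1 c10 h1] := IH; have [c2 c20 h2] := hP h.+1 (leqnn _).
have m0 : 0 < Num.min c1 c2 by rewrite lt_min c10.
exists (Num.min c1 c2) => // k; rewrite leq_eqVlt => /orP[/eqP ->|/h1].
- by apply: mono h2 => //; rewrite ge_min lexx orbT.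
- by apply: mono => //; rewrite ge_min lexx.
Qed.

(** Since [s k >= c * v k], the decrement gives [v k.+1 <= (1 - c^2) * v k]; passing between [s] and
    [v] at the two ends costs [c^-2]. *)
Lemma Lyapunov_decay (v s : nat -> R) (c : R) : 0 < c -> c < 1 ->
  (forall k, c * s k <= v k) -> (forall k, c * v k <= s k) ->
  (forall k, v k.+1 + c * s k <= v k) ->
  forall j k, (j <= k)%N -> s k <= (1 - c ^+ 2) ^+ (k - j) * s j / c ^+ 2.
Proof.
move=> c0 c1 h1 h2 h3 j k jk; have mu0 : 0 <= 1 - c ^+ 2 by nra.
have dec i : v (j + i)%N <= (1 - c ^+ 2) ^+ i * v j.
  elim: i => [|i IH]; first by rewrite addn0 expr0 mul1r.
  rewrite addnS exprS -mulrA; apply: le_trans (ler_wpM2l mu0 IH).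
  have := h3 (j + i)%N; have := ler_wpM2l (ltW c0) (h2 (j + i)%N); lra.
have := dec (k - j)%N; rewrite subnKC // => d.
have X0 : 0 <= (1 - c ^+ 2) ^+ (k - j) by apply: exprn_ge0.
rewrite ler_pdivlMr ?exprn_gt0 //.
have := ler_wpM2l X0 (h2 j); have := ler_wpM2l (ltW c0) d.
have := ler_wpM2l (ltW c0) (h1 k); lra.
Qed.

(** Telescoping the steps and dropping [v T >= 0] bounds [b^-1] times the output energy by
    [F + f2]. *)
Lemma supply_rate_sum (v e d : nat -> R) (b f2 F : R) : 0 < b -> 0 <= f2 ->
  (forall k, 0 <= v k) -> (forall k, v k.+1 + b^-1 * e k <= v k + f2 * d k) ->
  v 0%N <= F -> (forall T, \sum_(k < T) d k <= 1) ->
  forall T, \sum_(k < T) e k <= b * (F + f2).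
Proof.
move=> b0 f20 v0 step vF d1 T.
have : v T + b^-1 * \sum_(k < T) e k <= v 0%N + f2 * \sum_(k < T) d k.
  elim: T => [|T IH]; first by rewrite !big_ord0 !mulr0.
  by rewrite !big_ord_recr /=; have := step T; lra.
move=> h; rewrite -ler_pdivrMl //.
have := ler_wpM2l f20 (d1 T); have := v0 T; lra.
Qed.

(** [S] is [P^(-1/2)], so [S^-1 S^-1 = P]. *)
Lemma sqnorm_inv_sqrt k (P S : 'M[R]_k) x : posdef S -> S *m S = invmx P ->
  sqnorm (invmx S *m x) = bf P x x.
Proof.
move=> pS SS; have uS := posdef_unit pS.
rewrite -[LHS]mul1r -bf_scalar -bf_congr mulmx1 trmx_inv pS.1.
suff -> : P = invmx S *m invmx S by [].
have uSS : S *m S \in unitmx by rewrite unitmx_mul uS.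
by rewrite -[P]invmxK -SS -[RHS](mulKmx uSS) -[S *m S *m _]mulmxA mulKVmx // mulmxV // mulmx1.
Qed.

(** Write [z = Gamma x] with [x = (P^(1/2) pb, Q^(1/2) qb)]. The Schur complement bounds the storage
    by [f11 |P^(1/2) pb|^2 + f12 |Q^(1/2) qb|^2], and both squared norms are at most 1. *)
Lemma initial_storage_le n Nb (P Pmh : 'M[R]_n) (Q Qmh : 'M[R]_Nb) (R00 : 'M[R]_(n + Nb))
    (f11 f12 : R) z : posdef Pmh -> Pmh *m Pmh = invmx P ->
  posdef Qmh -> Qmh *m Qmh = invmx Q -> posdef R00 -> 0 < f11 -> 0 < f12 ->
  posdef (block_mx (diag2 (f11%:M : 'M[R]_n) (f12%:M : 'M[R]_Nb))
            (diag2 Pmh Qmh)^T (diag2 Pmh Qmh) R00) ->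
  in_init P Q z -> bf (invmx R00) z z <= f11 + f12.
Proof.
move=> pP PP pQ QQ pR f110 f120 pB [pb [qb [-> [hp hq]]]].
have psB := conj pB.1 (fun x => bf_posdef_ge0 x pB).
have := possemidef_Schur pR psB (col_mx (invmx Pmh *m pb) (invmx Qmh *m qb)).
rewrite /diag2 mul_block_col !mul0mx addr0 add0r !mulKVmx ?posdef_unit //.
rewrite bf_diag2 !bf_scalar (sqnorm_inv_sqrt _ pP PP) (sqnorm_inv_sqrt _ pQ QQ).
have := ler_wpM2l (ltW f110) hp; have := ler_wpM2l (ltW f120) hq.
rewrite -/(bf P pb pb) -/(bf Q qb qb); lra.
Qed.

End BilinearForms.

(** * Assembling the eventually periodic controller and its certificates *)

Theorem theorem1 (R : realType) (n Nb p : nat) (m : 'I_p -> nat) (nd nu ne : nat)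
  (G : plant R n Nb m nd nu ne)
  (P : 'M[R]_n) (Q : 'M[R]_Nb) (gamma : R) (hbar : nat)
  (* Gamma = diag(P^{-1/2}, Q^{-1/2}) *)
  (Pmh : 'M[R]_n) (Qmh : 'M[R]_Nb)
  (R0 : nat -> 'M[R]_(n + Nb))
  (Ri Si : nat -> forall i : 'I_p, 'M[R]_(m i))
  (b f11 f12 f2 g t : R)
  (r : nat) (NR : 'M[R]_(n + Nb + (\sum_i m i + ne), r)) :
  posdef P -> posdef Q ->
  C2s G = 1%:M -> C2p G = 0 -> D21 G = 0 ->
  posdef Pmh -> Pmh *m Pmh = invmx P ->
  posdef Qmh -> Qmh *m Qmh = invmx Q ->
  (forall k, (k <= hbar)%N ->
     [/\ posdef (R0 k), forall i, posdef (Ri k i) & forall i, posdef (Si k i)]) ->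
  R0 hbar.+1 = R0 hbar ->
  0 < b -> 0 < f11 -> 0 < f12 -> 0 < f2 -> 0 < g -> 0 < t ->
  (* Im N_R = Ker [B2s^T B2p^T D12^T],  N_R^T N_R = I *)
  (forall x : 'cV[R]_(n + Nb + (\sum_i m i + ne)),
     (exists y : 'cV[R]_r, x = NR *m y) <->
     row_mx (B2s G)^T (row_mx (B2p G)^T (D12 G)^T) *m x = 0) ->
  NR^T *m NR = 1%:M ->
  let H11 := Ass G in
  let H12 := row_mx (Asp G) (B1s G) in
  let H21 := col_mx (Aps G) (C1s G) in
  let H22 := block_mx (App G) (B1p G) (C1p G) (D11 G) in
  let H := block_mx H11 H12 H21 H22 in
  let Gam := diag2 Pmh Qmh in
  let F1 := diag2 (f11%:M : 'M[R]_n) (f12%:M : 'M[R]_Nb) in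
  b + f11 + f12 + f2 < 2 * gamma ->
  posdef (block_mx F1 Gam^T Gam (R0 0%N)) ->
  (forall k, (k <= hbar)%N ->
     negdef (NR^T *m
       (H *m diag2 (R0 k) (diag2 (bdiag (Ri k)) (g%:M : 'M[R]_nd)) *m H^T
        - diag2 (R0 k.+1) (diag2 (bdiag (Ri k)) (b%:M : 'M[R]_ne))) *m NR)) ->
  (forall k, (k <= hbar)%N ->
     posdef (block_mx
       (diag2 (bdiag (Si k)) (f2%:M : 'M[R]_nd)
          - H22^T *m diag2 (bdiag (Si k)) (t%:M : 'M[R]_ne) *m H22)
       H12^T H12 (R0 k.+1))) ->
  (forall k i, (k <= hbar)%N ->
     possemidef (block_mx (Ri k i) 1%:M 1%:M (Si k i))) ->
  possemidef (block_mx (g%:M : 'M[R]_1) 1%:M 1%:M (f2%:M : 'M[R]_1)) ->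
  possemidef (block_mx (t%:M : 'M[R]_1) 1%:M 1%:M (b%:M : 'M[R]_1)) ->
  exists K : nat -> sctrl R p (n + Nb) nu,
    ev_periodic hbar 1 K /\ robustly_stable G K /\ perf_lt G K P Q gamma.
Proof.
move=> _ _ C2s1 C2p0 D210 pPmh PP pQmh QQ pRS Rlast b0 f110 f120 f20 g0 t0 hNR _.
move=> H11 H12 H21 H22 H Gam F1 hgam hinit lmiR lmiS RS gf tb.
have pR0 k : (k <= hbar)%N -> posdef (R0 k) by move=> /pRS[].
have pR0S k : (k <= hbar)%N -> posdef (R0 k.+1).
  rewrite leq_eqVlt => /orP[/eqP ->|/pR0 //]; rewrite Rlast; exact: pR0.
have [Kf hKf] : {Kf : nat -> 'M[R]_(nu + \sum_i m i, n + Nb + \sum_i m i) &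
    forall k, (k <= hbar)%N ->
      dissipative G (invmx (R0 k)) (invmx (R0 k.+1)) b f2 (Kf k)}.
  apply: (boolp.choice (P := fun k K => (k <= hbar)%N ->
    dissipative G (invmx (R0 k)) (invmx (R0 k.+1)) b f2 K)) => k.
  (* Past [hbar] the value 0 is a mere default; time is clamped to [hbar] below. *)
  have [kh|kh] := leqP k hbar; last by exists 0.
  have [pRk pRi pSi] := pRS k kh.
  have [||||K hK] := exists_dissipative pRk (pR0S k kh) pRi pSi b0 f20 g0 t0 _
    (lmiR k kh) (lmiS k kh).
  - by move=> x /hNR.
  - by move=> i; apply: RS.
  - exact: invr_le_block gf.
  - by rewrite -[t]invrK lef_pV2 ?posrE ?invr_gt0 //; apply: invr_le_block tb.
  by exists K.
pose km k := minn k hbar; have kmh k : (km k <= hbar)%N by apply: geq_minr.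
pose V k := invmx (R0 (km k)); pose K k := Kf (km k).
have pV k : posdef (V k) by apply/posdef_invmx/pR0.
(* Up to [hbar] the clamped indices advance together; from [hbar] on, [R0 hbar.+1 = R0 hbar] keeps
   the storage constant. *)
have VS k : V k.+1 = invmx (R0 (km k).+1).
  rewrite /V /km; have [kh|kh] := ltnP k hbar; first by rewrite (minn_idPl kh).
  by rewrite (minn_idPr (leqW kh)) Rlast.
have dK k : dissipative G (V k) (V k.+1) b f2 (K k) by rewrite VS; apply: hKf.
exists (fun k => gain_ctrl (K k)); split; [|split; [split|]].
- move=> i k; rewrite /K /km; congr (gain_ctrl (Kf _)).
  by rewrite !(minn_idPr _) // -?addnA leq_addr.
- move=> k dl hdl z d.
  exact: (dissipative_wellposed (dK k) (pV k.+1) b0 C2s1 C2p0 D210 hdl).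
- have [c c0 hc] : exists2 c, 0 < c & forall k, (k <= hbar)%N ->
    [/\ c < 1, forall x, c * sqnorm x <= bf (invmx (R0 k)) x x,
      forall x, c * bf (invmx (R0 k)) x x <= sqnorm x &
      forall dl z th ph u y thc phc, admissible_param dl ->
      alg_eqs (c := gain_ctrl (Kf k)) G dl z 0 th ph u y thc phc ->
      let zn := Ass G *m z + Asp G *m th + B1s G *m 0 + B2s G *m u in
      bf (invmx (R0 k.+1)) zn zn + c * sqnorm z <= bf (invmx (R0 k)) z z].
    apply: uniform_le => [k c c' c'0 cc [c1 h1 h2 h3]|k kh].
      have c0 := lt_le_trans c'0 cc.
      have le s : 0 <= s -> c' * s <= c * s by move=> s0; apply: ler_wpM2r.
      split=> [|x|x|dl z th ph u y thc phc hdl alg]; first exact: le_lt_trans c1.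
      - exact: le_trans (le _ (sqnorm_ge0 x)) (h1 x).
      - apply: le_trans (le _ _) (h2 x); apply: le_trans (h1 x).
        by rewrite mulr_ge0 ?sqnorm_ge0 // ltW.
      - apply: le_trans (h3 _ _ _ _ _ _ _ _ hdl alg).
        by rewrite lerD2l le // sqnorm_ge0.
    have pP := posdef_invmx (pR0 k kh); have pPn := posdef_invmx (pR0S k kh).
    have [a a0 ha] := posdef_coercive pP.
    have [C C0 hC] := bf_bounded (invmx (R0 k)).
    have [eps eps0 step] := dissipative_step (hKf k kh) C2s1 C2p0 D210.
    (* [2^-1] ensures [c < 1], [a] the lower bound, [C^-1] the upper bound and [eps] the
       decrement. *)
    exists (Num.min (Num.min 2^-1 a) (Num.min C^-1 eps)).
      by rewrite !lt_min a0 eps0 !invr_gt0 C0 ltr0n.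
    set c := Num.min _ _.
    have [c2 [ca [cC ce]]] : c <= 2^-1 /\ c <= a /\ c <= C^-1 /\ c <= eps.
      by rewrite /c !ge_min !lexx !orbT.
    split=> [|x|x|dl z th ph u y thc phc hdl alg]; first by lra.
    - exact: le_trans (ler_wpM2r (sqnorm_ge0 x) ca) (ha x).
    - apply: le_trans (ler_wpM2r (bf_posdef_ge0 x pP) cC) _.
      by rewrite ler_pdivrMl.
    - have := step _ _ _ _ _ _ _ _ _ hdl alg; rewrite /=.
      set zn := (X in bf _ X X); set e := (X in b^-1 * sqnorm X).
      have -> : sqnorm (0 : 'cV[R]_nd) = 0 by apply/eqP; rewrite sqnorm_eq0.
      have := ler_wpM2r (sqnorm_ge0 z) ce.
      have := mulr_ge0 (ltW eps0) (addr_ge0 (sqnorm_ge0 th) (sqnorm_ge0 thc)).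
      have : 0 <= b^-1 * sqnorm e by rewrite mulr_ge0 ?sqnorm_ge0 // invr_ge0 ltW.
      by lra.
  (* [Lyapunov_decay] bounds squared norms by [c^-2 (1 - c^2)^(k - j)]; these constants are the
     square roots. *)
  move=> dl hdl; exists c^-1, (Num.sqrt (1 - c ^+ 2)).
  have [c1 _ _ _] := hc 0%N (leq0n _).
  have mu0 : 0 <= 1 - c ^+ 2 by nra.
  split; first by rewrite invr_gt0.
  split.
    rewrite sqrtr_ge0 /= -[ltRHS]sqrtr1 ltr_sqrt //.
    by have : 0 < c ^+ 2; [rewrite exprn_gt0|lra].
  move=> z e [th [ph [u [y [thc [phc traj]]]]]] j k jk.
  have := Lyapunov_decay (v := fun k => bf (V k) (z k) (z k)) (s := fun k => sqnorm (z k)) c0 c1.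
  move=> /(_ _ _ _ j k jk) decay.
  rewrite /vnorm -(@ler_pXn2r _ 2) ?nnegrE ?sqrtr_ge0 //; last first.
    by rewrite !mulr_ge0 ?sqrtr_ge0 ?exprn_ge0 ?sqrtr_ge0 // invr_ge0 ltW.
  rewrite !exprMn -exprM mulnC exprM !sqr_sqrtr ?sqnorm_ge0 // exprVn.
  rewrite -mulrA mulrC; apply: decay => i.
  + by have [_ h1 _ _] := hc _ (kmh i); apply: h1.
  + by have [_ _ h2 _] := hc _ (kmh i); apply: h2.
  + have [_ _ _ h3] := hc _ (kmh i); have [alg zE _] := traj i.
    by rewrite VS zE; apply: h3 alg.
- have Fpos : 0 < b + f11 + f12 + f2 by rewrite !addr_gt0.
  exists ((b + f11 + f12 + f2) / 2); split; first by apply/andP; split; lra.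
  move=> dl z d e hdl [th [ph [u [y [thc [phc traj]]]]]] z0 dn T.
  have := @supply_rate_sum R (fun k => bf (V k) (z k) (z k)) (fun k => sqnorm (e k))
    (fun k => sqnorm (d k)) b f2 (f11 + f12) b0 (ltW f20) _ _ _ dn T.
  move=> h; apply: le_trans (h _ _ _) _.
  + by move=> k; apply: bf_posdef_ge0.
  + move=> k; have [c c0 step] := dissipative_step (dK k) C2s1 C2p0 D210.
    have [alg zE eE] := traj k; have := step _ _ _ _ _ _ _ _ _ (hdl k) alg.
    rewrite /= -zE -eE; apply: le_trans; rewrite lerDl.
    by rewrite mulr_ge0 ?addr_ge0 ?sqnorm_ge0 // ltW.
  + apply: initial_storage_le pPmh PP pQmh QQ _ f110 f120 _ z0.
      exact/pR0/kmh.
    by rewrite /km min0n.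
  (* Arithmetic-geometric mean inequality for [b] and [f11 + f12 + f2]. *)
  + by have := sqr_ge0 (b - (f11 + f12 + f2)); nra.
Qed.
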